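(* Let $P$ be a rooted forest on $[n]$ whose labeling is natural, let $M$ be the transition matrix of the promotion graph of $P$ with edge weights given by indeterminates $x_1,\dots,x_n$, and let $\overline{M}=M+(x_1+\cdots+x_n)\mathbb{1}$. Then $$\det(\lambda\mathbb{1}-\overline{M})=\prod_{\substack{S\subseteq[n]\\ S \text{ upper set in } P}}(\lambda-x_S)^{d_S},$$ where $x_S=\sum_{i\in S}x_i$ and $d_S$ is the derangement number of $S$ in the lattice $L$ of upper sets of $P$. In other words, for each upper set $S$ of $P$ there is an eigenvalue $x_S$ of $\overline{M}$ with multiplicity $d_S$.
   Context: A rooted forest is a disjoint union of rooted trees, where a rooted tree is a connected finite poset in which each element is covered by at most one element. Natural labeling: $i\prec j$ implies $i<j$. $\mathcal{L}(P)=\{\pi\in S_n : i\prec j \Rightarrow \pi^{-1}_i<\pi^{-1}_j\}$, in one-line notation $\pi=\pi_1\cdots\pi_n$. $\pi\tau_i$ ($1\le i<n$) swaps $\pi_i,\pi_{i+1}$ if they are incomparable in $P$ and is $\pi$ otherwise; operators act on the right; $\partial_j=\tau_j\tau_{j+1}\cdots\tau_{n-1}$ for $1\le j\le n$. Promotion graph: vertices $\mathcal{L}(P)$, an edge $\pi\to\pi\partial_j$ of weight $x_{\pi_j}$ for each $\pi$ and $j\in[n]$. Transition matrix $M$: for $\pi'\ne\pi$, $M(\pi',\pi)$ is the sum of weights of edges $\pi\to\pi'$; $M(\pi,\pi)$ is minus the sum of weights of edges $\pi\to\pi'$ with $\pi'\ne\pi$. An upper set $S$ is a subset with $x\in S,\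 y\succeq x\Rightarrow y\in S$. $L$ is the set of upper sets of $P$ ordered by inclusion (minimum $\emptyset$, maximum $P$). For $S\in L$, $d_S=\sum_{T\in L,\,T\supseteq S}\mu(S,T)\,f([T,P])$, where $\mu$ is the Möbius function of $L$ and $f([T,P])$ is the number of maximal chains in the interval $[T,P]$ of $L$. *)

(* Defs.v *)
From HB Require Import structures.
From mathcomp Require Import all_boot all_order all_algebra all_fingroup.
From mathcomp Require Import mpoly.
Set Implicit Arguments. Unset Strict Implicit. Unset Printing Implicit Defensive.
Import GRing.Theory.
Local Open Scope ring_scope.

(* Posets on [n] are encoded on 'I_n (labels 0..n-1 stand for 1..n), with a
   boolean relation le (i <=_P j). *)
Section Defs.
Variable n : nat.
Variable le : rel 'I_n.

Definition lt_P (i j : 'I_n) : bool := (i != j) && le i j.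

Definition is_partial_order : Prop :=
  [/\ forall i, le i i,
      forall i j, le i j -> le j i -> i = j &
      forall i j k, le i j -> le j k -> le i k].

Definition covers (x y : 'I_n) : bool :=
  lt_P x y && [forall w, ~~ (lt_P x w && lt_P w y)].

Definition is_rooted_forest : Prop :=
  is_partial_order /\ forall x y z, covers x y -> covers x z -> y = z.

Definition natural_labeling : Prop :=
  forall i j : 'I_n, lt_P i j -> (i < j)%N.

Definition incomparable (i j : 'I_n) : bool := ~~ le i j && ~~ le j i.

(* pi : 'S_n in one-line notation: pi k = pi_(k+1); pi^-1 i = position of i *)
Definition is_linext (pi : 'S_n) : bool :=
  [forall i, forall j, lt_P i j ==> ((pi^-1)%g i < (pi^-1)%g j)%N].

Definition linext_set : {set 'S_n} := [set pi | is_linext pi].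

(* pi tau_{k+1}: swap positions k and k+1 (0-based) if the entries there are
   incomparable; identity otherwise (or if k+1 is out of range). *)
Definition tau (k : nat) (pi : 'S_n) : 'S_n :=
  match (insub k : option 'I_n), (insub k.+1 : option 'I_n) with
  | Some a, Some b => if incomparable (pi a) (pi b) then (tperm a b * pi)%g else pi
  | _, _ => pi
  end.

(* pi partial_{j+1} = pi tau_{j+1} tau_{j+2} ... tau_{n-1}  (j 0-based) *)
Definition partial_op (j : 'I_n) (pi : 'S_n) : 'S_n :=
  foldl (fun p k => tau k p) pi (iota j (n.-1 - j)).

Definition m_L := #|linext_set|.

Definition xvar (i : 'I_n) : {mpoly int[n]} := 'X_i.

Definition trans_matrix : 'M[{mpoly int[n]}]_m_L :=
  \matrix_(a < m_L, b < m_L)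
    let pi' := enum_val a in let pi := enum_val b in
    if a == b then
      - \sum_(j : 'I_n | partial_op j pi != pi) xvar (pi j)
    else \sum_(j : 'I_n | partial_op j pi == pi') xvar (pi j).

Definition Mbar : 'M[{mpoly int[n]}]_m_L :=
  trans_matrix + (\sum_(i : 'I_n) xvar i)%:M.

Definition upper_set (S : {set 'I_n}) : bool :=
  [forall x, forall y, (x \in S) && le x y ==> (y \in S)].

Definition xS (S : {set 'I_n}) : {mpoly int[n]} := \sum_(i in S) xvar i.

(* Moebius function of L (upper sets ordered by inclusion):
   mu(S,S) = 1, mu(S,T) = - sum_{S <= U < T} mu(S,U), mu(S,T) = 0 otherwise.
   Defined with fuel (n.+1 suffices since chains have length <= n). *)
Fixpoint mob_rec (k : nat) (S T : {set 'I_n}) : int :=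
  match k with
  | 0 => (S == T)%:Z
  | k'.+1 =>
    if S == T then 1
    else if S \proper T then
      - \sum_(U : {set 'I_n} | [&& upper_set U, S \subset U & U \proper T])
          mob_rec k' S U
    else 0
  end.

Definition mobius (S T : {set 'I_n}) : int := mob_rec n.+1 S T.

Definition chain_in (T : {set 'I_n}) (C : {set {set 'I_n}}) : bool :=
  [forall U, (U \in C) ==> upper_set U && (T \subset U)] &&
  [forall U, forall V, (U \in C) && (V \in C) ==> (U \subset V) || (V \subset U)].

Definition maximal_chain_in (T : {set 'I_n}) (C : {set {set 'I_n}}) : bool :=
  chain_in T C &&
  [forall U, upper_set U && (T \subset U) && (U \notin C) ==> ~~ chain_in T (U |: C)].

Definition fchains (T : {set 'I_n}) : nat :=
  #|[set C : {set {set 'I_n}} | maximal_chain_in T C]|.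

Definition derangement (S : {set 'I_n}) : int :=
  \sum_(T : {set 'I_n} | upper_set T && (S \subset T))
     mobius S T * (fchains T)%:Z.

End Defs.

(* Main.v *)
(* Write [Mbar = sum_i x_i G_i], where [G_i] is the 0/1 matrix of the operator
   promoting the letter [i], and let a word [u] act by composing promotions.
   If two linear extensions agree on a suffix, then after promoting [i] they
   still agree on it, and on one more letter when [i] is not in the suffix: in
   a forest the letter entering the suffix is the largest element of the chain
   above [i] lying outside of it.  Hence, with [S] the upper closure of the
   letters of [u], the fixed points of [u] are exactly the linear extensions
   with a certain fixed arrangement of [S] as a suffix; there are
   [f([S, P]) = sum_(T >= S) d_T] of them.  By induction on [k] the trace of
   [Mbar ^ k] is [sum_T d_T x_T ^ k], and in characteristic 0 the power sums
   determine the characteristic polynomial (Newton).  A negative [d_T] would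
   make [x_T] a root of one side only of the resulting identity
   [char_poly Mbar * prod_(d_T < 0) = prod_(d_T > 0)]. *)
Require Import Defs.
From HB Require Import structures.
From mathcomp Require Import all_boot all_order all_algebra all_fingroup.
From mathcomp Require Import mpoly zify.
Set Implicit Arguments. Unset Strict Implicit. Unset Printing Implicit Defensive.
Import Order.TTheory GRing.Theory Num.Theory.
Local Open Scope ring_scope.

(** * Newton's identities; characteristic polynomials from traces of powers *)

Lemma deriv_prod (R : comNzRingType) n (F : 'I_n -> {poly R}) :
  (\prod_i F i)^`() = \sum_i (F i)^`() * \prod_(k | k != i) F k.
Proof.
elim: n F => [|n IHn] F; first by rewrite !big_ord0 derivC.
rewrite [RHS]big_ord_recl [in LHS]big_ord_recl derivM IHn; congr (_ * _ + _).
  by rewrite [RHS]big_mkcond big_ord_recl /= mul1r; apply: eq_bigr.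
rewrite mulr_sumr; apply: eq_bigr => i _.
rewrite mulrCA [in RHS]big_mkcond big_ord_recl /=; congr (_ * (_ * _)).
by rewrite big_mkcond.
Qed.

(** Jacobi's formula: the product rule differentiates one row at a time, and Laplace expansion along
    that row produces the cofactors. *)
Lemma deriv_det (R : comNzRingType) n (M : 'M[{poly R}]_n) :
  (\det M)^`() = \sum_i \sum_j (M i j)^`() * cofactor M i j.
Proof.
pose Md i := \matrix_(k, j) if k == i then (M k j)^`() else M k j.
transitivity (\sum_i \det (Md i)); last first.
  apply: eq_bigr => i _; rewrite (expand_det_row _ i); apply: eq_bigr => j _.
  rewrite mxE eqxx /cofactor; congr (_ * (_ * \det _)).
  by apply/matrixP=> k l; rewrite !mxE eq_sym (negPf (neq_lift _ _)).
rewrite /determinant exchange_big /= raddf_sum; apply: eq_bigr => s _ /=.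
rewrite -mulr_sumr derivM -signr_odd (_ : (_ ^+ _)^`() = 0) ?mul0r ?add0r.
  rewrite deriv_prod; congr (_ * _); apply: eq_bigr => i _.
  rewrite [RHS](bigD1 i) //= mxE eqxx; congr (_ * _).
  by apply: eq_bigr => k /negPf ki; rewrite mxE ki.
by case: (odd _); rewrite ?expr0 ?expr1 ?derivN derivC ?oppr0.
Qed.

(* Newton's identities, from [tr (adj (X - A)) = P'] and a coefficientwise
   reading of [(X - A) * (X * adj (X - A)) = X * P]. *)
Lemma char_poly_newton (R : comNzRingType) n (A : 'M[R]_n) :
  exists N0, forall N j, (N0 <= N)%N ->
    (char_poly A)`_j *+ j =
      \sum_(i < N) (char_poly A)`_(j + i) * \tr (A ^+ i).
Proof.
set P := char_poly A.
pose B := \adj (char_poly_mx A).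
(* The factor ['X] shifts degrees by one, so that [C 0 = 0] and the two identities below also hold
   at [j = 0]. *)
pose C j := \matrix_(i, k) ('X * B i k)`_j.
have recC j : C j = (P`_j)%:M + A *m C j.+1.
  apply/matrixP=> i k.
  have /matrixP/(_ i k) := mul_mx_adj (char_poly_mx A).
  rewrite -/B -/(char_poly A) -/P {1}/char_poly_mx mulmxBl mul_scalar_mx !mxE.
  move/(congr1 (fun q => ('X * q)`_j.+1)).
  rewrite mulrBr coefB !(coefXM _ j.+1) /= => /eqP.
  rewrite subr_eq => /eqP ->; rewrite coefMn; congr (_ + _).
  rewrite coef_sum; apply: eq_bigr => l _.
  by rewrite [C _ _ _]mxE coefXM -coefCM [map_mx _ _ _ _]mxE.
have trC j : \tr (C j) = P`_j *+ j.
  transitivity ('X * P^`())`_j; last first.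
    by rewrite coefXM; case: j => [|j] //=; rewrite coef_deriv.
  rewrite /P /char_poly deriv_det mulr_sumr coef_sum; apply: eq_bigr => i _.
  rewrite mxE /B mxE (bigD1 i) //= big1 => [|k ki].
    by rewrite addr0 !mxE eqxx derivXsubC mul1r.
  by rewrite !mxE eq_sym (negPf ki) sub0r derivN derivC oppr0 mul0r.
pose s i k := size ('X * B i k); pose N0 := \max_i \max_k s i k.
have C0 j : (N0 <= j)%N -> C j = 0.
  move=> lej; apply/matrixP=> i k; rewrite [C _ _ _]mxE [RHS]mxE nth_default //.
  apply: leq_trans lej.
  apply: leq_trans (leq_bigmax (F := fun i => \max_k s i k) i).
  exact: (leq_bigmax (F := s i)).
exists N0 => N j leN; rewrite -trC.
suff -> : \tr (C j) = \sum_(i < N) P`_(j + i) * \tr (A ^+ i)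
                       + \tr (A ^+ N *m C (j + N)%N).
  by rewrite C0 ?mulmx0 ?mxtrace0 ?addr0 // (leq_trans leN) ?leq_addl.
elim: N {leN} => [|N IHN]; first by rewrite big_ord0 add0r addn0 expr0 mul1mx.
rewrite IHN big_ord_recr /= -addrA; congr (_ + _).
rewrite recC mulmxDr mxtraceD -scalemx1 -scalemxAr mxtraceZ mulmx1.
by rewrite mulmxA addnS exprSr.
Qed.

(** The zeroth traces force [m = n]. Newton's identity at [j < m] then expresses [m - j] times the
    coefficient of degree [j] through higher coefficients and traces, so descending induction from
    the leading coefficient 1 applies. *)
Lemma char_poly_eq_trace (R : idomainType) m n (A : 'M[R]_m) (B : 'M[R]_n) :
    (forall k, k.+1%:R != 0 :> R) ->
    (forall k, \tr (A ^+ k) = \tr (B ^+ k)) ->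
  char_poly A = char_poly B.
Proof.
move=> char0 eqtr.
have emn : m = n.
  have /eqP := eqtr 0; rewrite !expr0 !mxtrace1.
  wlog lemn : m n A B eqtr / (m <= n)%N => [IH|].
    case/orP: (leq_total m n) => [/IH|/IH H]; first exact.
    by rewrite eq_sym => /(H B A (fun k => esym (eqtr k)))->.
  rewrite -(subnK lemn) natrD -subr_eq0 opprD addrCA subrr addr0 oppr_eq0.
  by case: (n - m)%N => // k; rewrite (negPf (char0 k)).
subst n; have [N0 NA] := char_poly_newton A; have [N1 NB] := char_poly_newton B.
(* The successor makes the sums nonempty, so that the term [i = 0] can be split off. *)
pose N := (maxn N0 N1).+1.
have {}NA := fun j => NA N j (leqW (leq_maxl _ _)).
have {}NB := fun j => NB N j (leqW (leq_maxr _ _)).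
have lead (M : 'M[R]_m) : (char_poly M)`_m = 1.
  by have /eqP := char_poly_monic M; rewrite lead_coefE size_char_poly.
suff H d j : (m - j <= d)%N -> (char_poly A)`_j = (char_poly B)`_j.
  by apply/polyP=> j; apply: (H (m - j)%N).
elim: d j => [|d IHd] j led.
  have [ltmj|] := ltnP m j; first by rewrite !nth_default ?size_char_poly.
  by move=> lejm; rewrite (_ : j = m) ?lead //; lia.
have [ltjm|lemj] := ltnP j m; last by apply: IHd; lia.
have := NA j; have := NB j; rewrite /N !big_ord_recl !expr0 !mxtrace1 !addn0.
set sA := \sum_(i < _) _; set sB := \sum_(i < _) _.
have -> : sA = sB.
  by apply: eq_bigr => i _; rewrite eqtr IHd //= /bump; lia.
move: (_`_j) (_`_j) sB => b a t eb ea.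
(* The split-off term is the coefficient times [\tr 1 = m]; against the left side [*+ j] it leaves
   [m - j]. *)
have : (a - b) * (m - j)%:R = 0.
  have : a * m%:R - b * m%:R - (a *+ j - b *+ j) = 0.
    by rewrite ea eb (opprD _ t) (addrACA _ t) subrr addr0 subrr.
  by rewrite natrB ?(ltnW ltjm) // mulrBr !mulrBl (mulr_natr a j) (mulr_natr b j).
move/eqP; rewrite mulf_eq0 subr_eq0 => /orP[/eqP //|].
by rewrite -(subnSK ltjm) (negPf (char0 _)).
Qed.

Lemma diag_mxX (R : comNzRingType) n (r : 'rV[R]_n) k :
  diag_mx r ^+ k = diag_mx (\row_j r 0 j ^+ k).
Proof.
elim: k => [|k IHk].
  rewrite expr0 -[1]diag_const_mx; congr diag_mx.
  by apply/rowP=> j; rewrite !mxE expr0.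
rewrite exprS IHk [LHS]mulmx_diag; congr diag_mx.
by apply/rowP=> j; rewrite !mxE exprS.
Qed.

(** Realizes prescribed eigenvalues by a matrix, so that multisets of roots can be compared through
    traces. *)
Definition diag_seq (R : comNzRingType) (s : seq R) : 'M_(size s) :=
  diag_mx (\row_j s`_j).

Lemma mxtrace_diag_seqX (R : comNzRingType) (s : seq R) k :
  \tr (diag_seq s ^+ k) = \sum_(y <- s) y ^+ k.
Proof.
rewrite diag_mxX mxtrace_diag (big_nth 0) big_mkord.
by apply: eq_bigr => i _; rewrite !mxE.
Qed.

Lemma char_poly_diag_seq (R : comNzRingType) (s : seq R) :
  char_poly (diag_seq s) = \prod_(y <- s) ('X - y%:P).
Proof.
rewrite char_poly_trig ?diag_mx_is_trig // (big_nth 0) big_mkord.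
by apply: eq_bigr => i _; rewrite !mxE eqxx.
Qed.

Lemma block_diagX (R : comNzRingType) m n (A : 'M[R]_m) (B : 'M[R]_n) k :
  block_mx A 0 0 B ^+ k = block_mx (A ^+ k) 0 0 (B ^+ k).
Proof.
elim: k => [|k IHk]; first by rewrite !expr0 -scalar_mx_block.
by rewrite !exprS IHk [LHS]mulmx_block !mulmx0 !mul0mx !addr0 !add0r.
Qed.

Lemma char_poly_block_diag (R : comNzRingType) m n (A : 'M[R]_m) (B : 'M[R]_n) :
  char_poly (block_mx A 0 0 B) = char_poly A * char_poly B.
Proof. by rewrite /char_poly char_block_diag_mx det_ublock. Qed.

(** Since [d] may a priori be negative, the indices with [d i < 0] are moved to the left as an extra
    diagonal block; both sides are then matrices with equal traces of powers. *)
Lemma char_poly_from_traces (R : idomainType) m (A : 'M[R]_m) (I : finType)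
    (P : pred I) (x : I -> R) (d : I -> int) :
    (forall k, k.+1%:R != 0 :> R) -> injective x ->
    (forall k, \tr (A ^+ k) = \sum_(i | P i) x i ^+ k *~ d i) ->
  (forall i, P i -> 0 <= d i) /\
  char_poly A = \prod_(i | P i) ('X - (x i)%:P) ^+ `|d i|%N.
Proof.
move=> char0 injx trA.
pose sq (Q : pred I) :=
  flatten [seq nseq `|d i|%N (x i) | i <- index_enum I & P i && Q i].
have prod_sq Q : \prod_(y <- sq Q) ('X - y%:P) =
    \prod_(i | P i && Q i) ('X - (x i)%:P) ^+ `|d i|%N.
  rewrite big_flatten big_map big_filter; apply: eq_bigr => i _.
  by rewrite big_nseq iter_mulr_1.
have sum_sq Q k : \sum_(y <- sq Q) y ^+ k =
    \sum_(i | P i && Q i) x i ^+ k *+ `|d i|%N.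
  rewrite big_flatten big_map big_filter; apply: eq_bigr => i _.
  by rewrite big_nseq iter_addr_0.
pose neg i := d i < 0.
have eqA : char_poly A * \prod_(y <- sq neg) ('X - y%:P) =
    \prod_(y <- sq (predC neg)) ('X - y%:P).
  rewrite -!char_poly_diag_seq -char_poly_block_diag.
  apply: char_poly_eq_trace => // k.
  rewrite block_diagX mxtrace_block !mxtrace_diag_seqX !sum_sq trA.
  rewrite (bigID neg) /= addrAC -big_split /= big1 ?add0r => [|i /andP[_ ltd]].
    apply: eq_bigr => i /andP[_]; rewrite -leNgt => ged.
    by rewrite pmulrn gez0_abs.
  by rewrite pmulrn -mulrzDr ltz0_abs // subrr mulr0z.
have dge0 i : P i -> 0 <= d i.
  move=> Pi; rewrite leNgt; apply/negP => ltd.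
  have : root (\prod_(y <- sq neg) ('X - y%:P)) (x i).
    rewrite root_prod_XsubC; apply/flattenP; exists (nseq `|d i|%N (x i)).
      by apply: map_f; rewrite mem_filter Pi /neg ltd mem_index_enum.
    by rewrite mem_nseq eqxx andbT absz_gt0 lt_eqF.
  (* The right side only has roots [x j] with [d j >= 0], and injectivity of [x] would identify [j]
     with [i]. *)
  move=> xroot; have : root (\prod_(y <- sq (predC neg)) ('X - y%:P)) (x i).
    by rewrite -eqA rootM xroot orbT.
  rewrite root_prod_XsubC => /flattenP[_ /mapP[j +  ->]].
  rewrite mem_filter mem_nseq => /andP[/andP[_ nj] _] /andP[_ /eqP/injx ij].
  by move: nj; rewrite -ij /= /neg ltd.
split=> //; move: eqA; rewrite !prod_sq big_pred0 => [|i]; last first.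
  by apply/andP => -[/dge0]; rewrite /neg leNgt => /negP.
rewrite mulr1 => ->; apply: eq_bigl => i /=.
by rewrite /neg -leNgt; case Pi: (P i) => //=; rewrite dge0.
Qed.

(** * Moebius inversion over upper sets *)

Section Moebius.
Variables (n : nat) (le : rel 'I_n).
Local Notation upper := (upper_set le).

(** Recursive calls go to proper subsets of [T], so fuel above [#|T|] is never exhausted. This
    reconciles the fuel [n] inside the recursion with the [n.+1] of [mobius]. *)
Lemma mob_rec_fuel k k' (S T : {set 'I_n}) :
  (#|T| < k)%N -> (#|T| < k')%N -> mob_rec le k S T = mob_rec le k' S T.
Proof.
elim: k k' T => [|k IHk] [|k'] T //= ltk ltk'.
case: ifP => // _; case: ifP => // _; congr (- _).
apply: eq_bigr => U /and3P[_ _ /proper_card ltUT].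
by apply: IHk; apply: leq_trans ltUT _.
Qed.

Lemma mobius_out (S T : {set 'I_n}) : ~~ (S \subset T) -> mobius le S T = 0.
Proof.
rewrite /mobius /= => nST; case: eqP => [eST|_]; first by rewrite eST subxx in nST.
by rewrite properE (negPf nST).
Qed.

Lemma sum_mobius (S T : {set 'I_n}) : upper S -> upper T ->
  \sum_(U | upper U && (U \subset T)) mobius le S U = (S == T)%:Z.
Proof.
move=> uS uT; have [<-|neST] := eqVneq S T.
  rewrite (bigD1 S) ?uS //= big1 => [|U /andP[/andP[_ sUS] neUS]].
    by rewrite addr0 /mobius /= eqxx.
  apply: mobius_out; apply: contra neUS => sSU.
  by rewrite eqEsubset sUS.
have [sST|nsST] := boolP (S \subset T); last first.
  apply: big1 => U /andP[_ sUT]; apply: mobius_out.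
  by apply: contra nsST => /subset_trans; apply.
rewrite (bigD1 T) ?uT //= [in X in X + _]/mobius /= (negPf neST) properEneq neST sST.
apply/eqP; rewrite addrC subr_eq0; apply/eqP.
rewrite (bigID (fun U : {set _} => S \subset U)) /= [X in _ + X]big1 ?addr0.
  apply: eq_big => [U|U /andP[/andP[/andP[_ sUT] neUT] sSU]].
    by rewrite properEneq; case: (upper U); case: (S \subset U); rewrite ?andbF ?andbT //= andbC.
  apply: mob_rec_fuel; first by rewrite ltnS (leq_trans (max_card _)) ?card_ord.
  have ltUT : U \proper T by rewrite properEneq neUT.
  by apply: leq_trans (proper_card ltUT) (leq_trans (max_card _) _); rewrite card_ord.
by move=> U /andP[_]; apply: mobius_out.
Qed.

(* [derangement] is the Moebius transform of [fchains] for a left inverse of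
   the zeta matrix; a left inverse of a square matrix is a right inverse. *)
Lemma sum_derangement (S : {set 'I_n}) : upper S ->
  \sum_(T | upper T && (S \subset T)) derangement le T = (fchains le S)%:Z.
Proof.
move=> uS; pose L := [set T | upper T].
have LE (T : {set 'I_n}) : (T \in L) = upper T by rewrite inE.
pose mu : 'M[int]_#|L| := \matrix_(i, j) mobius le (enum_val i) (enum_val j).
pose zeta : 'M[int]_#|L| :=
  \matrix_(i, j) ((enum_val i : {set 'I_n}) \subset (enum_val j : {set 'I_n}))%:Z.
have mu_zeta : mu *m zeta = 1%:M.
  apply/matrixP=> i j; rewrite !mxE -(inj_eq enum_val_inj).
  have uE k : upper (enum_val (A := L) k) by rewrite -LE enum_valP.
  rewrite natz -sum_mobius ?uE // big_mkcondr -(eq_bigl _ _ LE) [RHS]big_enum_val.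
  by apply: eq_bigr => k _; rewrite !mxE; case: ifP; rewrite ?mulr1 ?mulr0.
have zeta_mu := mulmx1C mu_zeta.
pose f : 'cV[int]_#|L| := \col_j (fchains le (enum_val j))%:Z.
have SL : S \in L by rewrite LE.
have /matrixP/(_ (enum_rank_in SL S) 0) : zeta *m (mu *m f) = f.
  by rewrite mulmxA zeta_mu mul1mx.
rewrite [RHS]mxE enum_rankK_in // => <-; rewrite mxE big_mkcondr.
rewrite -(eq_bigl _ _ LE) [LHS]big_enum_val; apply: eq_bigr => k _.
rewrite !mxE enum_rankK_in //; case: ifP; rewrite ?mul0r // mul1r => _.
rewrite /derangement big_mkcondr -(eq_bigl _ _ LE) [LHS]big_enum_val.
apply: eq_bigr => j _; rewrite !mxE; case: ifP => // /negbT/mobius_out ->.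
by rewrite mul0r.
Qed.

End Moebius.

(** * Maximal chains of upper sets, counted recursively *)

Section MaximalChains.
Variables (n : nat) (le : rel 'I_n).
Hypothesis nat_le : natural_labeling le.
Local Notation upper := (upper_set le).
Implicit Types (S T U V : {set 'I_n}) (C D : {set {set 'I_n}}).

Lemma upper_setP S :
  reflect (forall x y, x \in S -> le x y -> y \in S) (upper S).
Proof.
apply: (iffP forallP) => [H x y xS lexy|H x].
  by have /forallP/(_ y) := H x; rewrite xS lexy.
by apply/forallP=> y; apply/implyP=> /andP[]; apply: H.
Qed.

Lemma upper_setT : upper [set: 'I_n].
Proof. by apply/upper_setP => *; rewrite inE. Qed.

Lemma le_leq i j : le i j -> (i <= j)%N.
Proof.
move=> leij; have [->//|neij] := eqVneq i j.
by apply/ltnW/nat_le; rewrite /lt_P neij.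
Qed.

Lemma maximal_chainP T C :
  reflect [/\ forall U, U \in C -> upper U /\ T \subset U,
              forall U V, U \in C -> V \in C -> (U \subset V) || (V \subset U) &
              forall U, upper U -> T \subset U ->
                (forall V, V \in C -> (U \subset V) || (V \subset U)) -> U \in C]
          (maximal_chain_in le T C).
Proof.
have chainP (B : {set {set 'I_n}}) : reflect ((forall U, U \in B -> upper U /\ T \subset U) /\
    forall U V, U \in B -> V \in B -> (U \subset V) || (V \subset U))
    (chain_in le T B).
  apply: (iffP andP) => -[H1 H2]; split.
  - by move=> U UB; have /forallP/(_ U) := H1; rewrite UB => /andP.
  - move=> U V UB VB.
    by have /forallP/(_ U)/forallP/(_ V) := H2; rewrite UB VB.
  - by apply/forallP=> U; apply/implyP=> /H1[-> ->].
  - apply/forallP=> U; apply/forallP=> V; apply/implyP=> /andP[]; exact: H2.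
apply: (iffP andP) => [[/chainP[H1 H2] /forallP H3]|[H1 H2 H3]].
  split=> // U uU TU HU; apply/negPn/negP => nUC.
  have := H3 U; rewrite uU TU nUC => /chainP[]; split=> [V|V W].
    by case/setU1P => [->|/H1].
  case/setU1P => [->|VC] /setU1P[->|WC]; rewrite ?subxx ?HU //.
    by rewrite orbC HU.
  exact: H2.
split; first exact/chainP.
apply/forallP=> U; apply/implyP=> /andP[/andP[uU TU] nUC].
apply/negP => /chainP[_ HU]; case/negP: nUC; apply: H3 => // V VC.
by apply: HU; rewrite !inE ?eqxx ?VC ?orbT.
Qed.

(** Nothing lies strictly between [S] and [x |: S], so a set containing [S] and comparable with
    [x |: S] either is [S] or contains [x |: S]. *)
Lemma maximal_chain_setU1 S x D : upper S -> x \notin S -> upper (x |: S) ->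
    S \notin D -> x |: S \in D ->
  maximal_chain_in le S (S |: D) = maximal_chain_in le (x |: S) D.
Proof.
move=> uS nxS uxS nSD xSD; apply/maximal_chainP/maximal_chainP => -[H1 H2 H3].
  have sub U : U \in D -> x |: S \subset U.
    move=> UD; have UC : U \in S |: D by rewrite inE UD orbT.
    have xSC : x |: S \in S |: D by rewrite inE xSD orbT.
    case/orP: (H2 _ _ xSC UC) => // sUxS.
    have [_ sSU] := H1 _ UC.
    rewrite subUset sSU andbT sub1set; apply: contraR nSD => nxU.
    suff -> : S = U by [].
    apply/eqP; rewrite eqEsubset sSU; apply/subsetP => y yU.
    have /setU1P[yx|//] := subsetP sUxS y yU.
    by rewrite -yx yU in nxU.
  split=> [U UD|U V UD VD|U uU sU HU].
  - by split; [case: (H1 U); rewrite ?inE ?UD ?orbT | apply: sub].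
  - by apply: H2; rewrite inE ?UD ?VD orbT.
  - have SU : S \subset U := subset_trans (subsetUr _ _) sU.
    have /setU1P[US|//] : U \in S |: D.
      by apply: H3 => // V /setU1P[->|/HU//]; rewrite SU orbT.
    by move: sU; rewrite US subUset sub1set (negPf nxS).
split=> [U /setU1P[->//|UD]|U V|U uU sSU HU].
- by have [uU] := H1 U UD; rewrite subUset => /andP[].
- have sub W : W \in D -> S \subset W.
    by move=> WD; have [_] := H1 W WD; rewrite subUset => /andP[].
  case/setU1P => [->|UD] /setU1P[->|VD]; rewrite ?subxx ?sub ?orbT //.
  exact: H2.
- have [|sUxS] := orP (HU _ (setU1r _ xSD)).
    move=> sUxS; have [xU|nxU] := boolP (x \in U).
      suff -> : U = x |: S by rewrite inE xSD orbT.
      by apply/eqP; rewrite eqEsubset sUxS subUset sub1set xU.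
    suff -> : U = S by rewrite setU11.
    apply/eqP; rewrite eqEsubset sSU andbT; apply/subsetP => y yU.
    have /setU1P[yx|//] := subsetP sUxS y yU.
    by rewrite -yx yU in nxU.
  apply/setU1P; right; apply: H3 => // V VD.
  by apply: HU; rewrite inE VD orbT.
Qed.

Lemma fchains_setT : fchains le [set: 'I_n] = 1%N.
Proof.
apply/eqP/cards1P; exists [set setT]; apply/setP=> C; rewrite !inE.
apply/maximal_chainP/eqP => [[H1 _ H3]|->].
  apply/setP=> U; rewrite inE; apply/idP/eqP => [/H1[_]|->].
    by rewrite subTset => /eqP.
  by apply: H3 => [|//|V _]; rewrite ?upper_setT ?subsetT ?orbT.
split=> [U|U V|U _]; rewrite ?inE.
- by move/eqP->; rewrite upper_setT.
- by move=> /eqP-> /eqP->; rewrite subxx.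
- by rewrite subTset.
Qed.

(** By naturality the largest label in [V] outside [S] is maximal there, so everything strictly
    above it is already in [S]. *)
Lemma upper_set_addable S V : upper S -> upper V -> S \proper V ->
  exists x, [/\ x \in V, x \notin S & upper (x |: S)].
Proof.
move=> uS uV /properP[_ [x0 x0V nx0S]].
have P0 : (x0 \in V) && (x0 \notin S) by rewrite x0V.
case: (@arg_maxnP _ x0 (fun x => (x \in V) && (x \notin S)) val P0) => x /andP[xV nxS] maxx.
exists x; split=> //; apply/upper_setP => y z /setU1P[->|yS] leyz; last first.
  by rewrite setU1r // (upper_setP _ uS y).
apply/setU1P; have [zS|nzS] := boolP (z \in S); [by right|left].
apply/val_inj/eqP; rewrite eqn_leq (le_leq leyz) andbT; apply: maxx.
by rewrite nzS (upper_setP _ uV x).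
Qed.

(** A maximal chain from [S] contains exactly one [x |: S], and deleting [S] leaves a maximal chain
    from that set. *)
Lemma fchains_rec S : upper S -> S != setT ->
  fchains le S = (\sum_(x | (x \notin S) && upper (x |: S)) fchains le (x |: S))%N.
Proof.
move=> uS neST; pose A := [set C | maximal_chain_in le S C].
transitivity (\sum_(C in A)
   \sum_(x | (x \notin S) && upper (x |: S)) (x |: S \in C))%N.
  rewrite [LHS]/fchains -sum1_card; apply: eq_bigr => C.
  rewrite inE => /maximal_chainP[H1 H2 H3].
  (* [setT] is comparable with everything, hence lies in [C]; it seeds the choice of a smallest
     member [V] other than [S]. *)
  have TC : setT \in C.
    by apply: H3 => [|//|V _]; rewrite ?upper_setT ?subsetT ?orbT.
  have P0 : (setT \in C) && (setT != S) by rewrite TC eq_sym.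
  case: (@arg_minnP _ setT (fun V => (V \in C) && (V != S))
           (fun V => #|V|) P0) => V /andP[VC neVS] minV.
  have [uV sSV] := H1 _ VC.
  have [|x [xV nxS uxS]] := upper_set_addable uS uV.
    by rewrite properEneq eq_sym neVS.
  (* All members other than [S] contain [V], hence [x |: S], so maximality applies. *)
  have xSC : x |: S \in C.
    apply: H3 => // [|W WC]; first exact: subsetUr.
    have [_ sSW] := H1 _ WC.
    have [->|neWS] := eqVneq W S; first by rewrite subsetUr orbT.
    suff sVW : V \subset W by rewrite subUset sub1set sSW (subsetP sVW).
    case/orP: (H2 _ _ VC WC) => // sWV.
    suff -> : W = V by [].
    by apply/eqP; rewrite eqEcard sWV minV // WC.
  rewrite (bigD1 x) /= ?nxS // xSC big1 // => y /andP[/andP[nyS uyS] neyx].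
  apply/eqP; rewrite eqb0; apply/negP => ySC.
  have : (x |: S) = (y |: S).
    apply/eqP; case/orP: (H2 _ _ xSC ySC) => sub; last rewrite eq_sym.
      by rewrite eqEcard sub !cardsU1 nxS nyS /= leqnn.
    by rewrite eqEcard sub !cardsU1 nxS nyS /= leqnn.
  move/setP/(_ y); rewrite !inE eqxx (negPf nyS) (negPf neyx) //.
rewrite exchange_big; apply: eq_bigr => x /andP[nxS uxS].
rewrite -big_mkcondr /= sum1dep_card.
have inj : {in [set D | maximal_chain_in le (x |: S) D] &, injective (fun D => S |: D)}.
  move=> D D'; rewrite !inE => /maximal_chainP[H _ _] /maximal_chainP[H' _ _] eqD.
  have nS (B : {set {set 'I_n}}) : (forall U, U \in B -> upper U /\ x |: S \subset U) -> S \notin B.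
    move=> HB; apply/negP => /HB[_]; rewrite subUset sub1set (negPf nxS) //.
  by rewrite -(setU1K (nS D H)) -(setU1K (nS D' H')) eqD.
rewrite [RHS]/fchains -(card_in_imset inj); apply: eq_card => C; rewrite !inE.
apply/andP/imsetP => [[maxC xSC]|[D]].
  have neS : x |: S != S.
    by apply: contraNneq nxS => <-; rewrite setU11.
  have SC : S \in C.
    case/maximal_chainP: maxC => H1 _ H3; apply: H3 => // V /H1[_ ->] //.
  exists (C :\ S); last by rewrite setD1K.
  rewrite inE -maximal_chain_setU1 ?setD1K //; first by rewrite !inE eqxx.
  by rewrite !inE neS.
rewrite inE => maxD ->; case/maximal_chainP: (maxD) => H1 H2 H3.
have xSD : x |: S \in D by apply: H3 => // V /H1[_ ->].
split; last by rewrite inE xSD orbT.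
rewrite (maximal_chain_setU1 uS nxS uxS) //.
by apply/negP => /H1[_]; rewrite subUset sub1set (negPf nxS).
Qed.

End MaximalChains.

(** * Promotion acting on linear extensions and their suffixes *)

Section Promotion.
Variables (n : nat) (le : rel 'I_n).
Local Notation L := (linext_set le).
Implicit Types (p q r : 'S_n) (S : {set 'I_n}) (u : seq 'I_n).

Definition suffix_set m p : {set 'I_n} := [set x | (m <= (p^-1)%g x)%N].

Definition agree m p q := [forall k : 'I_n, (m <= k)%N ==> (p k == q k)].

Definition run j d p := foldl (fun q k => tau le k q) p (iota j d).

(** Edges are weighted by the letter at the starting position; indexing by letters instead of
    positions gives one operator per indeterminate. *)
Definition hat i p := partial_op le ((p^-1)%g i) p.

Definition act u p := foldl (fun q i => hat i q) p u.

Definition up_closure u : {set 'I_n} := [set y | has (fun x => le x y) u].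

Lemma agreeP m p q :
  reflect (forall k : 'I_n, (m <= k)%N -> p k = q k) (agree m p q).
Proof.
apply: (iffP forallP) => H k; first by move=> mk; have := H k; rewrite mk => /eqP.
by apply/implyP=> /H/eqP.
Qed.

Lemma suffix_setE m p (k : 'I_n) : (p k \in suffix_set m p) = (m <= k)%N.
Proof. by rewrite inE permK. Qed.

Lemma agree_sym m p q : agree m p q = agree m q p.
Proof. by apply/agreeP/agreeP => H k /H. Qed.

Lemma agree_n p q : agree n p q.
Proof. by apply/agreeP=> k; rewrite leqNgt ltn_ord. Qed.

Lemma agree_trans m p q r : agree m p q -> agree m q r -> agree m p r.
Proof. by move=> /agreeP H1 /agreeP H2; apply/agreeP=> k mk; rewrite H1 ?H2. Qed.

Lemma agree_inv m p q x : agree m p q ->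
  (m <= (p^-1)%g x)%N -> (q^-1)%g x = (p^-1)%g x.
Proof.
move=> /agreeP H mx; apply: (@perm_inj _ q).
by rewrite permKV -H // permKV.
Qed.

Lemma agree_suffix m p q : agree m p q -> suffix_set m p = suffix_set m q.
Proof.
move=> H; apply/setP=> x; rewrite !inE; apply/idP/idP => mx.
  by rewrite (agree_inv H mx).
by rewrite agree_sym in H; rewrite (agree_inv H mx).
Qed.

Lemma suffix_set_rec (e : 'I_n) p :
  suffix_set e p = p e |: suffix_set e.+1 p.
Proof.
apply/setP=> x; rewrite !inE -[x](permKV p) permK.
by rewrite (inj_eq perm_inj) leq_eqVlt eq_sym.
Qed.

Lemma linextP p :
  reflect (forall a b : 'I_n, lt_P le (p a) (p b) -> (a < b)%N) (p \in L).
Proof.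
rewrite inE; apply: (iffP forallP) => [H a b lab|H i].
  by have /forallP/(_ (p b)) := H (p a); rewrite lab !permK.
apply/forallP=> j; apply/implyP; rewrite -{1}[i](permKV p) -{1}[j](permKV p).
exact: H.
Qed.

Lemma tauE k p (a b : 'I_n) : a = k :> nat -> b = k.+1 :> nat ->
  tau le k p = if incomparable le (p a) (p b) then (tperm a b * p)%g else p.
Proof. by move=> <- eb; rewrite /tau -eb !valK. Qed.

Lemma tauP k p : tau le k p = p \/ exists a b : 'I_n,
  [/\ a = k :> nat, b = k.+1 :> nat, incomparable le (p a) (p b)
    & tau le k p = (tperm a b * p)%g].
Proof.
rewrite /tau; case: insubP => [a _ ak|_]; last by left.
case: insubP => [b _ bk|_]; last by left.
by case: ifP => H; [right; exists a, b | left].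
Qed.

Lemma tau_linext k p : p \in L -> tau le k p \in L.
Proof.
have [->//|[a [b [ak bk /andP[nab nba] ->]]]] := tauP k p.
move=> /linextP H; apply/linextP=> c d; rewrite !permM => lcd.
have := H _ _ lcd; move: lcd; rewrite /lt_P.
have eqvE (i j : 'I_n) : i != j -> (i : nat) != j by [].
case: tpermP => [->|->|/eqP/eqvE ca /eqP/eqvE cb];
case: tpermP => [->|->|/eqP/eqvE da /eqP/eqvE db];
  rewrite ?(negPf nab) ?(negPf nba) ?andbF // => _; lia.
Qed.

Lemma tau_other k p (c : 'I_n) : c != k :> nat -> c != k.+1 :> nat ->
  tau le k p c = p c.
Proof.
move=> ck ck1; have [->//|[a [b [ak bk _ ->]]]] := tauP k p.
rewrite permM tpermD //; apply/eqP => e; first by rewrite -e ak eqxx in ck.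
by rewrite -e bk eqxx in ck1.
Qed.

(** Both entries compared by [tau] lie in the common suffix, so the same decision is taken on either
    side. *)
Lemma tau_agree m k p q : (m <= k)%N -> agree m p q ->
  agree m (tau le k p) (tau le k q).
Proof.
move=> mk /agreeP H; apply/agreeP => c mc.
have [ltkn|] := ltnP k.+1 n; last first.
  move=> lenk; have [->|[a [b [_ bk _ _]]]] := tauP k p; last first.
    by have := ltn_ord b; rewrite bk ltnNge lenk.
  have [->|[a [b [_ bk _ _]]]] := tauP k q; first exact: H.
  by have := ltn_ord b; rewrite bk ltnNge lenk.
pose a := Ordinal (ltnW ltkn); pose b := Ordinal ltkn.
rewrite !(@tauE k _ a b) // -!H //= ?(leqW mk) //.
case: ifP => _; rewrite ?permM H //.
by case: tpermP => //= *; rewrite (leqW mk).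
Qed.

Lemma runS j d p : run j d.+1 p = tau le (j + d) (run j d p).
Proof. by rewrite /run -addn1 iotaD foldl_cat. Qed.

Lemma runD j d d' p : run j (d + d') p = run (j + d) d' (run j d p).
Proof. by rewrite /run iotaD foldl_cat. Qed.

Lemma run_linext j d p : p \in L -> run j d p \in L.
Proof. by elim: d => // d IHd pL; rewrite runS tau_linext ?IHd. Qed.

Lemma run_low j d p (c : 'I_n) : (c < j)%N -> run j d p c = p c.
Proof. by move=> cj; elim: d => // d IHd; rewrite runS tau_other //; lia. Qed.

Lemma run_high j d p (c : 'I_n) : (j + d < c)%N -> run j d p c = p c.
Proof.
by elim: d => // d IHd cj; rewrite runS tau_other ?IHd //; lia.
Qed.

Lemma run_agree m j d p q : (m <= j)%N -> agree m p q ->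
  agree m (run j d p) (run j d q).
Proof.
move=> mj H; elim: d => // d IHd; rewrite !runS tau_agree //.
exact: leq_trans mj (leq_addr _ _).
Qed.

Lemma hat_linext i p : p \in L -> hat i p \in L.
Proof. exact: run_linext. Qed.

Lemma act_linext u p : p \in L -> act u p \in L.
Proof. by elim: u p => //= i u IHu p pL; apply/IHu/hat_linext. Qed.

(** * In a forest, promotion preserves or lengthens common suffixes *)

Hypotheses (forest : is_rooted_forest le) (nat_le : natural_labeling le).

Let le_refl : reflexive le. Proof. by case: forest => -[]. Qed.
Let le_anti i j : le i j -> le j i -> i = j.
Proof. by case: forest => -[_ H _] _; apply: H. Qed.
Let le_trans i j k : le i j -> le j k -> le i k.
Proof. by case: forest => -[_ _ H] _; apply: H. Qed.

(** The smallest label strictly above [i] and weakly below [a] is a cover: by naturality anything in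
    between would have a smaller label. *)
Lemma lt_cover i a : lt_P le i a -> exists2 c, covers le i c & le c a.
Proof.
move=> lia; have P0 : lt_P le i a && le a a by rewrite lia le_refl.
case: (@arg_minnP _ a (fun c => lt_P le i c && le c a) val P0) => c.
move=> /andP[lic lca] minc; exists c => //; rewrite /covers lic /=.
apply/forallP=> w; apply/negP=> /andP[liw lwc].
have := minc w; rewrite liw (le_trans _ lca); last by case/andP: lwc.
by move=> /(_ isT); rewrite leqNgt (nat_le lwc).
Qed.

(** The unique cover of [i] lies below both [a] and [b], and the argument repeats from it; [n - i]
    decreases because labels grow upwards. *)
Lemma forest_chain i a b : le i a -> le i b -> le a b || le b a.
Proof.
have [m] := ubnP (n - i); elim: m i => // m IHm i lem lia lib.
have [<-|neia] := eqVneq i a; first by rewrite lib.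
have [<-|neib] := eqVneq i b; first by rewrite lia orbT.
have [|c coc lca] := @lt_cover i a; first by rewrite /lt_P neia.
have [|d cod ldb] := @lt_cover i b; first by rewrite /lt_P neib.
have ecd : c = d by case: forest => _; apply; eassumption.
apply: (IHm c) => //; last by rewrite ecd.
have /andP[/nat_le ltic _] := coc.
by have := ltn_ord c; move: lem; lia.
Qed.

Lemma suffix_upper m p : p \in L -> upper_set le (suffix_set m p).
Proof.
move=> /linextP H; apply/upper_setP=> x y; rewrite !inE => mx lexy.
have [<-//|nexy] := eqVneq x y.
apply: leq_trans mx _; apply: ltnW; apply: H.
by rewrite /lt_P !permKV nexy.
Qed.

(* While promotion carries a letter rightwards, that letter is the largest of
   the chain above the starting letter seen so far. *)
Lemma run_carried (j e : 'I_n) d p : p \in L -> e = (j + d)%N :> nat ->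
  le (p j) (run j d p e) /\
  forall c, le (p j) c -> ((p^-1)%g c <= e)%N -> le c (run j d p e).
Proof.
move=> pL; elim: d e => [|d IHd] e ee.
  have -> : e = j by apply: val_inj; rewrite /= ee addn0.
  split=> [|c ljc cj]; first exact: le_refl.
  have [<-|ne] := eqVneq (p j) c; first exact: le_refl.
  move/linextP: pL => /(_ j ((p^-1)%g c)).
  by rewrite /lt_P permKV ne ljc => /(_ isT); rewrite ltnNge cj.
have lt_e : (j + d < n)%N by have := ltn_ord e; rewrite ee; lia.
pose a := Ordinal lt_e; have [lja maxa] := IHd a erefl.
set q := run j d p in lja maxa *.
have qe : q e = p e by rewrite run_high // ee addnS.
have pe c : ((p^-1)%g c <= e)%N -> c = p e \/ ((p^-1)%g c <= a)%N.
  rewrite leq_eqVlt => /orP[/eqP/val_inj <-|]; first by left; rewrite permKV.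
  by rewrite ee addnS ltnS; right.
rewrite runS -/q (@tauE _ q a e erefl (etrans ee (addnS _ _))).
(* If a swap occurs, [p e] cannot lie above [p j]: [forest_chain] would make it comparable with the
   carried letter. *)
have [|ncomp] := boolP (incomparable le (q a) (q e)).
  move=> /andP[nae nea]; rewrite permM tpermR; split=> // c ljc /pe[ec|]; last exact: maxa.
  have := forest_chain ljc lja.
  by rewrite ec -qe (negPf nae) (negPf nea).
(* Without a swap the entry at [e] takes over; it lies above the former carried letter because [q]
   is a linear extension. *)
have lae : le (q a) (q e).
  move: ncomp; rewrite negb_and !negbK => /orP[//|lea].
  have : lt_P le (q e) (q a).
    rewrite /lt_P lea andbT (inj_eq perm_inj); apply/eqP=> eea.
    by move: ee; rewrite eea /=; lia.
  by move/linextP: (run_linext j d pL) => H /H; rewrite ee /=; lia.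
split=> [|c ljc /pe[->|ca]]; first exact: le_trans lae.
  by rewrite qe le_refl.
exact: le_trans (maxa _ ljc ca) lae.
Qed.

Lemma hat_low m i p (c : 'I_n) : i \in suffix_set m p -> (c < m)%N ->
  hat i p c = p c.
Proof. by rewrite inE => mi cm; rewrite [LHS]run_low ?(leq_trans cm). Qed.

Lemma suffix_low m p q : (forall c : 'I_n, (c < m)%N -> p c = q c) ->
  suffix_set m p = suffix_set m q.
Proof.
move=> H; apply/setP=> x; rewrite !inE leqNgt [RHS]leqNgt; congr (~~ _).
apply/idP/idP => cm.
  have e := H _ cm; rewrite permKV in e.
  by rewrite e permK.
have e := H _ cm; rewrite permKV in e.
by rewrite -e permK.
Qed.

Lemma hat_suffix m i p : i \in suffix_set m p ->
  suffix_set m (hat i p) = suffix_set m p.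
Proof. by move=> iS; apply: suffix_low => c; apply: hat_low. Qed.

Lemma hat_agree m i p q : i \in suffix_set m p -> agree m p q ->
  agree m (hat i p) (hat i q).
Proof.
rewrite inE => mi H; rewrite /hat (agree_inv H mi).
exact: run_agree.
Qed.

(** By [run_carried], the letter arriving at position [m] is the maximum of the elements above [i]
    outside the suffix from [m.+1]. This depends only on the common suffix, and the rest of the run
    stays within the enlarged one. *)
Lemma hat_agree_grow m i p q : (m < n)%N -> p \in L -> q \in L ->
  i \notin suffix_set m.+1 p -> agree m.+1 p q ->
  agree m (hat i p) (hat i q).
Proof.
move=> ltmn pL qL ip H; have iq := ip; rewrite (agree_suffix H) in iq.
pose e := Ordinal ltmn.
rewrite !inE -!ltnNge !ltnS in ip iq.
have hatE r : ((r^-1)%g i <= m)%N ->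
    hat i r = run m (n.-1 - m) (run ((r^-1)%g i) (m - (r^-1)%g i) r).
  move=> ir; rewrite -[in run m](subnKC ir) -runD.
  by congr run; lia.
rewrite !hatE //; apply: run_agree => //.
have high r (k : 'I_n) : ((r^-1)%g i <= m)%N -> (m < k)%N ->
    run ((r^-1)%g i) (m - (r^-1)%g i) r k = r k.
  by move=> ir mk; rewrite run_high // subnKC.
have carried r : r \in L -> ((r^-1)%g i <= m)%N ->
    let c := run ((r^-1)%g i) (m - (r^-1)%g i) r e in
    le i c /\ forall d, le i d -> ((r^-1)%g d <= m)%N -> le d c.
  move=> rL ir; have := @run_carried ((r^-1)%g i) e (m - (r^-1)%g i) r rL.
  by rewrite permKV subnKC //; apply.
(* The letter carried to [e] in one extension lies outside the common suffix, hence competes in the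
   maximum taken in the other; [le_anti] will identify the two. *)
have pos (r s : 'S_n) : ((s^-1)%g i <= m)%N -> agree m.+1 r s ->
    ((r^-1)%g (run ((s^-1)%g i) (m - (s^-1)%g i) s e) <= m)%N.
  move=> ir /agreeP ars; rewrite leqNgt; apply/negP; set c := run _ _ _ _ => mc.
  have := ars _ mc; rewrite permKV -(high _ _ ir mc) => /perm_inj ee.
  by move: mc; rewrite -ee ltnn.
apply/agreeP=> k; rewrite leq_eqVlt => /orP[/eqP mk|mk]; last first.
  by rewrite !high //; move/agreeP: H; apply.
have -> : k = e by apply: val_inj.
have [lp maxp] := carried p pL ip; have [lq maxq] := carried q qL iq.
by apply: le_anti; [apply: maxq => // | apply: maxp => //]; apply: pos;
   rewrite // agree_sym.
Qed.

Lemma act_agree_mono m u p q : (m <= n)%N -> p \in L -> q \in L ->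
  agree m p q -> agree m (act u p) (act u q).
Proof.
move=> lemn; elim: u p q => //= i u IHu p q pL qL H.
apply: IHu; rewrite ?hat_linext //.
have [iS|niS] := boolP (i \in suffix_set m p); first exact: hat_agree.
case: m lemn H niS => [|m] lemn H niS; first by rewrite inE in niS.
have /agreeP H' := hat_agree_grow lemn pL qL niS H.
by apply/agreeP => k /ltnW; apply: H'.
Qed.

Lemma act_low m u p (c : 'I_n) : {subset u <= suffix_set m p} ->
  (c < m)%N -> act u p c = p c.
Proof.
move=> + cm; elim: u p => //= i u IHu p sub.
have iS : i \in suffix_set m p by rewrite sub ?mem_head.
rewrite IHu ?(hat_low iS) // => j ju; rewrite hat_suffix //.
by rewrite sub // inE ju orbT.
Qed.

(** The first letter of [u] outside the suffix yields the gain: earlier letters keep the suffix set,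
    later ones keep the agreement. *)
Lemma act_agree_grow m u p q : (m < n)%N -> p \in L -> q \in L ->
    agree m.+1 p q -> ~ {subset u <= suffix_set m.+1 p} ->
  agree m (act u p) (act u q).
Proof.
move=> ltmn; elim: u p q => [|i u IHu] p q pL qL H nsub; first by case: nsub.
have [iS|niS] := boolP (i \in suffix_set m.+1 p); last first.
  have Hhat := hat_agree_grow ltmn pL qL niS H.
  exact: (act_agree_mono _ (ltnW ltmn) (hat_linext _ pL) (hat_linext _ qL) Hhat).
apply: IHu; rewrite ?hat_linext //; first exact: hat_agree.
rewrite hat_suffix // => sub; case: nsub => j /predU1P[->//|].
exact: sub.
Qed.

(** * Fixed points of words of promotions *)

Lemma up_closure_sub u S : upper_set le S ->
  (up_closure u \subset S) = all (mem S) u.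
Proof.
move=> /upper_setP uS; apply/subsetP/allP => [H x xu|H y].
  by apply: H; rewrite inE; apply/hasP; exists x.
by rewrite inE => /hasP[x /H xS]; apply: uS.
Qed.

Lemma up_closure_upper u : upper_set le (up_closure u).
Proof.
apply/upper_setP => x y; rewrite !inE => /hasP[z zu lezx] lexy.
by apply/hasP; exists z => //; apply: le_trans lexy.
Qed.

(** If [u] stayed inside the suffix from [k.+1], so would its upper closure, the suffix from
    [m <= k]; but the letter at position [k] does not. *)
Lemma act_agree_step m k u p q : p \in L -> q \in L ->
    suffix_set m p = up_closure u -> (m <= k < n)%N ->
  agree k.+1 p q -> agree k (act u p) (act u q).
Proof.
move=> pL qL Sp /andP[mk kn] H; apply: act_agree_grow => // sub.
have := suffix_setE k.+1 p (Ordinal kn); rewrite /= ltnn => /negP[].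
have /subsetP : up_closure u \subset suffix_set k.+1 p.
  by rewrite up_closure_sub ?suffix_upper //; apply/allP.
by apply; rewrite -Sp suffix_setE.
Qed.

Lemma act_low_up_closure m u p (c : 'I_n) :
  suffix_set m p = up_closure u -> (c < m)%N -> act u p c = p c.
Proof.
move=> Sp cm; apply: (act_low _ cm); rewrite Sp => i iu.
by rewrite inE; apply/hasP; exists i.
Qed.

Lemma act_suffix m u p :
  suffix_set m p = up_closure u -> suffix_set m (act u p) = up_closure u.
Proof.
by move=> Sp; rewrite -Sp; apply: suffix_low => c; apply: act_low_up_closure.
Qed.

(** Iterating [act u] is a contraction: consecutive iterates agree on one more position each time,
    hence from [m] on after [n - m] rounds, while positions below [m] never change. *)
Lemma act_fixed_exists m u p : (m <= n)%N -> p \in L ->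
    suffix_set m p = up_closure u ->
  exists q, [/\ q \in L, suffix_set m q = up_closure u & act u q = q].
Proof.
move=> lemn pL Sp; pose P k := iter k (act u) p.
have PL k : P k \in L by elim: k => //= k IHk; apply: act_linext.
have SP k : suffix_set m (P k) = up_closure u.
  by elim: k => //= k IHk; apply: act_suffix.
have conv d : (d <= n - m)%N -> agree (n - d) (P d) (P d.+1).
  elim: d => [|d IHd] led; first by rewrite subn0 agree_n.
  apply: (act_agree_step (PL d) (PL d.+1) (SP d)); first by lia.
  by rewrite subnSK; [apply/IHd/ltnW | lia].
exists (P (n - m)%N); split=> //; apply/permP=> c.
have [cm|mc] := ltnP c m; first exact: act_low_up_closure.
have /agreeP H := conv _ (leqnn _).
by rewrite [RHS]H //; lia.
Qed.

(** The same contraction, applied to two fixed points, forces them to agree from [m] on. Conversely,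
    [u] preserves the agreement with [p] and leaves positions below [m] alone. *)
Lemma act_fixedE m u p q : (m <= n)%N -> p \in L ->
    suffix_set m p = up_closure u -> act u p = p -> q \in L ->
  (act u q == q) = agree m q p.
Proof.
move=> lemn pL Sp fp qL; apply/eqP/idP => [fq|H].
  have conv d : (d <= n - m)%N -> agree (n - d) p q.
    elim: d => [|d IHd] led; first by rewrite subn0 agree_n.
    rewrite -fp -fq; apply: (act_agree_step (m := m)) => //; first by lia.
    by rewrite subnSK; [apply/IHd/ltnW | lia].
  by rewrite agree_sym; have := conv _ (leqnn _); rewrite subKn.
apply/permP=> c; have [cm|mc] := ltnP c m.
  by apply: act_low_up_closure cm; rewrite (agree_suffix H).
have /agreeP/(_ c mc) := act_agree_mono u lemn qL pL H.
by rewrite fp => ->; move/agreeP: H => ->.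
Qed.

(** * Counting linear extensions with a prescribed suffix *)

(** The letter [x] is moved right to [e] by adjacent swaps. Each neighbour passed is not above [x],
    since [x |: suffix_set e.+1 p] is upper, and not below it, since [p] is a linear extension. *)
Lemma extend_suffix (e : 'I_n) p x : p \in L -> x \notin suffix_set e.+1 p ->
    upper_set le (x |: suffix_set e.+1 p) ->
  exists q, [/\ q \in L, agree e.+1 q p & q e = x].
Proof.
have [d] := ubnP (e - (p^-1)%g x); elim: d p => // d IHd p led pL nxS uxS.
have := nxS; rewrite inE -ltnNge ltnS leq_eqVlt => /orP[/eqP/val_inj ex|ltxe].
  by exists p; split; rewrite -?ex ?permKV //; apply/agreeP.
set a := (p^-1)%g x in led ltxe.
have ltb : (a.+1 < n)%N by apply: leq_ltn_trans ltxe (ltn_ord e).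
pose b := Ordinal ltb.
have pa : p a = x by rewrite permKV.
have neab : a != b by rewrite -val_eqE /=; lia.
have incab : incomparable le (p a) (p b).
  rewrite /incomparable; apply/andP; split; apply/negP => H.
    have := (upper_setP _ _ uxS) x (p b); rewrite setU11 -{1}pa => /(_ isT H).
    rewrite !inE permK -pa (inj_eq perm_inj) eq_sym (negPf neab) /=.
    by rewrite ltnNge ltxe.
  have : lt_P le (p b) (p a) by rewrite /lt_P H (inj_eq perm_inj) eq_sym neab.
  by move/linextP: pL => HL /HL /=; lia.
have tE := @tauE a p a b erefl erefl; rewrite incab in tE.
have agr : agree e.+1 (tau le a p) p.
  by apply/agreeP => k ek; rewrite tau_other //; lia.
have xE : ((tau le a p)^-1)%g x = b.
  by apply: (@perm_inj _ (tau le a p)); rewrite permKV tE permM tpermR.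
have [|||| q [qL qa qe]] := IHd (tau le a p).
- by rewrite xE /=; lia.
- exact: tau_linext.
- by rewrite (agree_suffix agr).
- by rewrite (agree_suffix agr).
by exists q; split => //; apply: agree_trans agr.
Qed.

(** Removing the smallest label of [S] leaves an upper set by naturality; that letter is then put
    back just before the suffix obtained by induction. *)
Lemma suffix_exists S : upper_set le S ->
  exists2 p, p \in L & suffix_set (n - #|S|) p = S.
Proof.
have [k] := ubnP #|S|; elim: k S => // k IHk S leS uS.
have [->|[x0 x0S]] := set_0Vmem S.
  exists 1%g; first by apply/linextP => a b; rewrite !perm1; apply: nat_le.
  apply/setP=> x; rewrite !inE cards0 subn0 leqNgt.
  by rewrite ltn_ord.
case: (@arg_minnP _ x0 (fun x => x \in S) val x0S) => x xS minx.
have cS : #|S| = #|S :\ x|.+1 by rewrite (cardsD1 x S) xS.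
have uS' : upper_set le (S :\ x).
  apply/upper_setP=> y z; rewrite !inE => /andP[neyx yS] leyz.
  rewrite (upper_setP _ _ uS _ _ yS leyz) andbT; apply: contraNneq neyx => zx.
  rewrite zx in leyz; apply/eqP; apply: contraTeq (minx _ yS) => neyx.
  by rewrite -ltnNge nat_le // /lt_P neyx.
have [||p pL pS] := IHk (S :\ x) => //; first by rewrite -ltnS -cS.
have leSn : (#|S| <= n)%N by apply: leq_trans (max_card _) _; rewrite card_ord.
have lte : (n - #|S| < n)%N by lia.
pose e := Ordinal lte.
have ee : e.+1 = (n - #|S :\ x|)%N.
  by rewrite -[_.+1]/(n - #|S|).+1 cS subnSK // -cS.
have [||q [qL qp qe]] := @extend_suffix e p x pL.
- by rewrite ee pS setD11.
- by rewrite ee pS setD1K.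
exists q => //; rewrite (suffix_set_rec e) qe (agree_suffix qp) ee pS.
by rewrite setD1K.
Qed.

(** Reading leftwards from the fixed suffix adds one letter at a time and traces a maximal chain of
    upper sets; sorting by the next letter matches [fchains_rec]. *)
Lemma card_agree m p : (m <= n)%N -> p \in L ->
  #|[set q in L | agree m q p]| = fchains le (suffix_set m p).
Proof.
elim: m p => [|m IHm] p lemn pL.
  have -> : suffix_set 0 p = setT by apply/setP=> x; rewrite !inE.
  rewrite fchains_setT; apply/eqP/cards1P; exists p.
  apply/setP=> q; rewrite in_set inE; apply/andP/eqP => [[_ /agreeP H]|->].
    by apply/permP=> c; apply: H.
  by split=> //; apply/agreeP.
pose e := Ordinal lemn; pose S := suffix_set e.+1 p.
have neS : S != setT.
  apply/eqP => /setP/(_ (p e)); rewrite suffix_setE inE ltnn //.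
rewrite -/S fchains_rec ?suffix_upper // -sum1_card.
rewrite (partition_big (fun q : 'S_n => q e)
           (fun x => (x \notin S) && upper_set le (x |: S))) /=; last first.
  move=> q; rewrite in_set => /andP[qL aq].
  rewrite {1}/S -(agree_suffix aq) suffix_setE ltnn /S -(agree_suffix aq).
  by rewrite -suffix_set_rec suffix_upper.
apply: eq_bigr => x /andP[nxS uxS].
have [q [qL aq qe]] := extend_suffix pL nxS uxS.
have <- : suffix_set m q = x |: S.
  by rewrite (suffix_set_rec e) qe (agree_suffix aq).
rewrite -IHm ?(ltnW lemn) // -sum1_card; apply: eq_bigl => r.
rewrite !in_set -andbA; congr (_ && _); apply/andP/agreeP => [[ar /eqP re] k|H].
  rewrite leq_eqVlt => /orP[/eqP mk|mk].
    by have -> : k = e by [apply: val_inj]; rewrite re qe.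
  by move/agreeP: (agree_trans ar (etrans (agree_sym _ _ _) aq)); apply.
split; last by rewrite H ?qe.
by apply: agree_trans aq; apply/agreeP => k /ltnW; apply: H.
Qed.

Lemma card_act_fixed u :
  #|[set q in L | act u q == q]| = fchains le (up_closure u).
Proof.
have uS := up_closure_upper u; set S := up_closure u in uS *.
have lem : (n - #|S| <= n)%N by rewrite leq_subr.
have [p pL pS] := suffix_exists uS.
have [q [qL qS fq]] := act_fixed_exists lem pL pS.
have -> : fchains le S = fchains le (suffix_set (n - #|S|) q) by rewrite qS.
rewrite -card_agree //; apply: eq_card => r; rewrite !in_set.
have [rL|//] := boolP (is_linext le r).
by rewrite (act_fixedE lem qL qS fq) ?inE.
Qed.

End Promotion.

(** * Traces of powers of the transition matrix *)

Section TransitionMatrix.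
Variables (n : nat) (le : rel 'I_n).
Hypotheses (forest : is_rooted_forest le) (nat_le : natural_labeling le).
Local Notation L := (linext_set le).
Local Notation R := {mpoly int[n]}.

Definition act_mx (u : seq 'I_n) : 'M[R]_(m_L le) :=
  \matrix_(a, b) (act le u (enum_val b) == enum_val a)%:R.

(** On the diagonal, the total weight minus the weights of the non-loops leaves exactly the
    loops. *)
Lemma Mbar_act_mx : Mbar le = \sum_i xvar i *: act_mx [:: i].
Proof.
apply/matrixP=> a b; rewrite !mxE summxE.
set p := enum_val b; set q := enum_val a.
have -> : \sum_i (xvar i *: act_mx [:: i]) a b =
    \sum_(j | partial_op le j p == q) xvar (p j).
  rewrite (reindex_inj (@perm_inj _ p)) [RHS]big_mkcond; apply: eq_bigr => j _.
  by rewrite !mxE /= /hat -/p -/q permK; case: ifP; rewrite ?mulr1 ?mulr0.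
have [eab|neab] := eqVneq a b; last by rewrite mulr0n addr0.
rewrite (_ : q = p) ?/q ?eab // mulr1n [X in _ + X](reindex_inj (@perm_inj _ p)) /=.
rewrite [X in _ + X](bigID (fun j => partial_op le j p == p)) /=.
by rewrite [LHS]addrC addrK.
Qed.

(** Columns index sources, so the right factor acts first and its letter is prepended. *)
Lemma act_mx_mul u i : act_mx u *m act_mx [:: i] = act_mx (i :: u).
Proof.
apply/matrixP=> a b; rewrite !mxE /=; set q := hat le i (enum_val b).
have qL : q \in L by apply/hat_linext/enum_valP.
rewrite (bigD1 (enum_rank_in qL q)) //= !mxE enum_rankK_in //= eqxx mulr1.
rewrite big1 ?addr0 // => c nec; rewrite !mxE /= -/q.
have [eqc|] := eqVneq q (enum_val c); last by rewrite mulr0.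
by case/eqP: nec; apply: enum_val_inj; rewrite enum_rankK_in.
Qed.

Lemma mxtrace_act_mx u : \tr (act_mx u) = (fchains le (up_closure le u))%:R.
Proof.
rewrite -card_act_fixed // -sum1_card natr_sum big_mkcond /=.
rewrite [RHS](eq_bigr (fun q => if q \in L then (act le u q == q)%:R else 0)).
  by rewrite -big_mkcond big_enum_val; apply: eq_bigr => a _; rewrite mxE.
by move=> q _; rewrite in_set; case: (q \in L); case: eqP.
Qed.

(** The word [u] is there for the induction: each factor [Mbar] is absorbed into it as one more
    letter. *)
Lemma mxtrace_act_mx_MbarX u k :
  \tr (act_mx u *m Mbar le ^+ k) =
    \sum_(T | upper_set le T && (up_closure le u \subset T))
       xS T ^+ k *~ derangement le T.
Proof.
elim: k u => [|k IHk] u.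
  rewrite expr0 mulmx1 mxtrace_act_mx pmulrn -sum_derangement; last first.
    exact: up_closure_upper.
  by rewrite rmorph_sum /=; apply: eq_bigr => T _; rewrite expr0.
rewrite exprS mulmxA {1}Mbar_act_mx mulmx_sumr mulmx_suml raddf_sum /=.
transitivity (\sum_i \sum_(T | upper_set le T && (up_closure le (i :: u) \subset T))
    xvar i * xS T ^+ k *~ derangement le T).
  apply: eq_bigr => i _; rewrite -scalemxAr -scalemxAl mxtraceZ act_mx_mul IHk.
  by rewrite mulr_sumr; apply: eq_bigr => T _; rewrite mulrzAr.
(* An upper set [T] contains the closure of [i :: u] when it contains that of [u] and [i] itself;
   summing [xvar i] over these [i] gives the new factor [xS T]. *)
rewrite (exchange_big_dep (fun T => upper_set le T && (up_closure le u \subset T))) /=.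
  apply: eq_bigr => T /andP[uT uuT].
  rewrite exprS {1}/xS mulr_suml mulrz_suml; apply: eq_bigl => i.
  by move: uuT; rewrite uT !up_closure_sub //= => ->; rewrite andbT.
move=> i T _ /andP[uT]; rewrite uT !up_closure_sub //= => /andP[_ ->] //.
Qed.

End TransitionMatrix.

(** * Distinctness of the [xS S], and the conclusion *)

Lemma xS_inj n : injective (@xS n).
Proof.
have coefE (S : {set 'I_n}) i : (xS S)@_U_(i) = (i \in S)%:R.
  rewrite /xS raddf_sum /= big_mkcond (bigD1 i) //= big1 ?addr0.
    by case: ifP; rewrite // /xvar mcoeffX eqxx.
  by move=> j neji; case: ifP => // _; rewrite /xvar mcoeffX eq_mnm1 (negPf neji).
move=> S T eST; apply/setP=> i; have := coefE S i; rewrite eST coefE.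
by case: (i \in S); case: (i \in T).
Qed.

Lemma natr_mpoly_neq0 n k : k.+1%:R != 0 :> {mpoly int[n]}.
Proof. by rewrite -mpolyC_nat mpolyC_eq0 pnatr_eq0. Qed.

Theorem theorem5p2 (n : nat) (le : rel 'I_n)
    (Hforest : is_rooted_forest le) (Hnat : natural_labeling le) :
  (forall S : {set 'I_n}, upper_set le S -> 0 <= derangement le S) /\
  char_poly (Mbar le) =
    \prod_(S : {set 'I_n} | upper_set le S)
       ('X - (xS S)%:P) ^+ `|derangement le S|%N.
Proof.
apply: char_poly_from_traces => [k||k]; first exact: natr_mpoly_neq0.
  exact: xS_inj.
(* The empty word has empty closure and acts as the identity, so the sum runs over all upper
   sets. *)
have := mxtrace_act_mx_MbarX Hforest Hnat [::] k.
have -> : act_mx le [::] = 1%:M.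
  by apply/matrixP=> a b; rewrite !mxE /= (inj_eq enum_val_inj) eq_sym.
rewrite mul1mx => ->; apply: eq_bigl => T.
have [uT|//] := boolP (upper_set le T).
by rewrite up_closure_sub.
Qed.
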